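(* Let $(M,g)$ be a semi-Riemannian manifold of dimension $n\ge3$ satisfying $P\cdot\mathcal R=L\,Q(g,\mathcal R)$ for some $L\in C^\infty(M)$. Then: (i) $P\cdot S=R\cdot S=L\,Q(g,S)$, i.e. $M$ is Ricci pseudosymmetric, and thus $E=L\kappa g-LnS+S^2$. (ii) $n^2S^2-2n\kappa S+\kappa^2g=0$ and $\kappa^{(2)}=\frac{\kappa^2}{n}$. Moreover, if $M$ is a Riemannian manifold, then $M$ is an Einstein manifold. (iii) $S\wedge S=g\wedge S^2$. (iv) $P\cdot\mathcal S=L\,Q(g,\mathcal S)$ if and only if, for all vector fields $X_1,X_2,X,Y$, $$R(Y,X_1,X_2,\mathcal SX)+R(Y,X_2,X_1,\mathcal SX)-R(X,X_1,X_2,\mathcal SY)-R(X,X_2,X_1,\mathcal SY)=0$$ holds or $$S(X,X_2)S(X_1,Y)-S(X,X_1)S(X_2,Y)+g(X_2,Y)S^2(X,X_1)-g(X,X_2)S^2(X_1,Y)=0.$$ Especially, if $Q(S,R)=0$ on $M$, then $P\cdot\mathcal R=0$ implies $P\cdot\mathcal S=0$.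
   Context: $(M,g)$ is a connected smooth semi-Riemannian manifold of dimension $n\ge 3$; $R$ is the $(0,4)$ Riemann curvature tensor and $\mathcal R$ the $(1,3)$ one, $g(\mathcal R(X,Y)X_1,X_2)=R(X,Y,X_1,X_2)$, with the sign convention that the Ricci tensor $S(X_2,X_3)$ is the $g$-trace of $R(X_1,X_2,X_3,X_4)$ over $X_1,X_4$; $\kappa$ is the scalar curvature; $\mathcal S$ is the Ricci operator, $g(\mathcal SX,Y)=S(X,Y)$, $S^2(X,Y)=g(\mathcal S^2X,Y)$, $\kappa^{(2)}=\mathrm{trace}(\mathcal S^2)$. $E(X,Y)$ is the $(0,2)$-tensor obtained by contracting $R(X_1,X,Y,\mathcal SX_2)$ over $X_1,X_2$. Einstein means $S=\frac{\kappa}{n}g$. Projective curvature tensor: $P(X_1,X_2,X_3,X_4)=R(X_1,X_2,X_3,X_4)-\frac{1}{n-1}\left[S(X_2,X_3)g(X_1,X_4)-S(X_1,X_3)g(X_2,X_4)\right]$. An endomorphism $\mathscr L$ of vector fields acts on a $(0,k)$-tensor $H$ by $(\mathscr LH)(X_1,\dots,X_k)=-\sum_iH(X_1,\dots,\mathscr LX_i,\dots,X_k)$ and on a $(1,k-1)$-tensor $\mathcal H$ by $(\mathscr L\mathcal H)(X_1,\dots,X_{k-1})=\mathscr L(\mathcal H(X_1,\dots,X_{k-1}))-\sum_i\mathcal H(X_1,\dots,\mathscr LX_i,\dots,X_{k-1})$. For a $(0,4)$-tensor $D$ with associated $(1,3)$-tensor $\mathcal D$ ($g(\mathcal D(X,Y)X_1,X_2)=D(X,Y,X_1,X_2)$),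 $D\cdot H$ and $D\cdot\mathcal H$ are obtained with $\mathscr L=\mathcal D(X,Y)$ ($X,Y$ placed as last arguments); for a symmetric $(0,2)$-tensor $A$, $Q(A,H)$ and $Q(A,\mathcal H)$ are obtained with $\mathscr L=X\wedge_AY$, $(X\wedge_AY)Z=A(Y,Z)X-A(X,Z)Y$. Kulkarni–Nomizu product: $(A\wedge F)(X_1,X_2,X_3,X_4)=A(X_1,X_4)F(X_2,X_3)+A(X_2,X_3)F(X_1,X_4)-A(X_1,X_3)F(X_2,X_4)-A(X_2,X_4)F(X_1,X_3)$. *)

(* Defs.v *)
From HB Require Import structures.
From mathcomp Require Import all_boot all_order all_algebra.
From mathcomp Require Import all_classical all_reals all_analysis.

Set Implicit Arguments.
Unset Strict Implicit.
Unset Printing Implicit Defensive.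

Import Order.TTheory GRing.Theory Num.Theory.
Import numFieldNormedType.Exports.

Local Open Scope classical_set_scope.
Local Open Scope ring_scope.

Definition evec {R : realType} {n : nat} (i : 'I_n) : 'rV[R]_n := delta_mx 0 i.

Fixpoint Ck {R : realType} {n : nat} (k : nat) (U : set 'rV[R]_n)
    (h : 'rV[R]_n -> R) : Prop :=
  (forall x, U x -> {for x, continuous h}) /\
  if k is k'.+1 then
    (forall x, U x -> forall i, derivable h x (evec i)) /\
    (forall i, Ck k' U (fun x => 'D_(evec i) h x))
  else True.

Definition smooth_on {R : realType} {n : nat} (U : set 'rV[R]_n)
  (h : 'rV[R]_n -> R) : Prop := forall k, Ck k U h.

(* [param a] is the inverse of the chart [coord a]; [coord a] is meaningful on
   [dom a] only, and [param a] on [coord a @` dom a] only. *)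
Record manifold (R : realType) (n : nat) := Manifold {
  carrier :> topologicalType;
  manifold_hausdorff : hausdorff_space carrier;
  manifold_second_countable : @second_countable carrier;
  chart : Type;
  dom : chart -> set carrier;
  coord : chart -> carrier -> 'rV[R]_n;
  param : chart -> 'rV[R]_n -> carrier;
  dom_open : forall a, open (dom a);
  coord_open : forall a, open (coord a @` dom a);
  coordK : forall a p, dom a p -> param a (coord a p) = p;
  coord_continuous : forall a p, dom a p -> {for p, continuous (coord a)};
  param_continuous : forall a x, (coord a @` dom a) x ->
    {for x, continuous (param a)};
  dom_cover : forall p, exists a, dom a p;
  transition_smooth : forall a b j,
    smooth_on (coord a @` (dom a `&` dom b))
      (fun x => coord b (param a x) 0 j)
}.

Section Manifold.
Context {R : realType} {n : nat} {M : manifold R n}.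
Local Notation V := 'rV[R]_n.

Definition smooth_in (a : chart M) (f : M -> R) : Prop :=
  smooth_on (coord a @` dom a) (f \o param a).

Definition smooth_fun (f : M -> R) : Prop := forall a, smooth_in a f.

Definition pd (a : chart M) (i : 'I_n) (f : M -> R) (p : M) : R :=
  'D_(evec i) (f \o param a : V -> R) (coord a p).

(* Row [i], column [j]: the i-th partial derivative, in the chart [a], of the
   j-th coordinate of [b].  A tangent vector at [p] with row of components [v]
   in [a] has components [v *m jac a b p] in [b]. *)
Definition jac (a b : chart M) (p : M) : 'M[R]_n :=
  \matrix_(i, j) pd a i (fun q => coord b q 0 j) p.

End Manifold.

Record vector_field (R : realType) (n : nat) (M : manifold R n) :=
  VectorField {
  vf :> chart M -> M -> 'rV[R]_n;
  vf_smooth : forall a i, smooth_in a (fun p => vf a p 0 i);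
  vf_transform : forall a b p, dom a p -> dom b p ->
    vf b p = vf a p *m jac a b p
}.

(* [gmx g a p] is the matrix of components of the metric in the chart [a]. The
   signature is locally constant, hence constant when [M] is connected. *)
Record metric (R : realType) (n : nat) (M : manifold R n) := Metric {
  gmx :> chart M -> M -> 'M[R]_n;
  gmx_smooth : forall a i j, smooth_in a (fun p => gmx a p i j);
  gmx_sym : forall a p, dom a p -> (gmx a p)^T = gmx a p;
  gmx_unit : forall a p, dom a p -> gmx a p \in unitmx;
  gmx_transform : forall a b p, dom a p -> dom b p ->
    gmx a p = jac a b p *m gmx b p *m (jac a b p)^T
}.

(* The tangent space at a point is represented, through a chart, by the rows
   of components; [G] is the matrix of the metric there. *)
Section TensorAlgebra.
Context {R : realType} {n : nat}.
Local Notation V := 'rV[R]_n.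
Implicit Types (G : 'M[R]_n) (A F : V -> V -> R) (D : V -> V -> V -> V -> R).

Definition ip G (X Y : V) : R := (X *m G *m Y^T) 0 0.

(* the vector representing the linear form [w]: ip G (sharp G w) X = w X *)
Definition sharp G (w : V -> R) : V := (\row_j w (evec j)) *m invmx G.

Definition contract G A : R :=
  \sum_i \sum_j invmx G i j * A (evec i) (evec j).

(* the (1,3)-tensor associated with a (0,4)-tensor *)
Definition assoc13 G D (X Y X1 : V) : V := sharp G (D X Y X1).

Definition act02 (l : V -> V) A (X1 X2 : V) : R :=
  - (A (l X1) X2 + A X1 (l X2)).

Definition act04 (l : V -> V) D (X1 X2 X3 X4 : V) : R :=
  - (D (l X1) X2 X3 X4 + D X1 (l X2) X3 X4
     + D X1 X2 (l X3) X4 + D X1 X2 X3 (l X4)).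

Definition act11 (l : V -> V) (H : V -> V) (X1 : V) : V :=
  l (H X1) - H (l X1).

Definition act13 (l : V -> V) (H : V -> V -> V -> V) (X1 X2 X3 : V) : V :=
  l (H X1 X2 X3) - (H (l X1) X2 X3 + H X1 (l X2) X3 + H X1 X2 (l X3)).

Definition wedge_end A (X Y Z : V) : V := A Y Z *: X - A X Z *: Y.

Definition dot02 G D A (X1 X2 X Y : V) : R := act02 (assoc13 G D X Y) A X1 X2.
Definition dot11 G D H (X1 X Y : V) : V := act11 (assoc13 G D X Y) H X1.
Definition dot13 G D H (X1 X2 X3 X Y : V) : V :=
  act13 (assoc13 G D X Y) H X1 X2 X3.

Definition Q02 A F (X1 X2 X Y : V) : R := act02 (wedge_end A X Y) F X1 X2.
Definition Q04 A D (X1 X2 X3 X4 X Y : V) : R :=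
  act04 (wedge_end A X Y) D X1 X2 X3 X4.
Definition Q11 A H (X1 X Y : V) : V := act11 (wedge_end A X Y) H X1.
Definition Q13 A H (X1 X2 X3 X Y : V) : V := act13 (wedge_end A X Y) H X1 X2 X3.

Definition kulkarni_nomizu A F (X1 X2 X3 X4 : V) : R :=
  A X1 X4 * F X2 X3 + A X2 X3 * F X1 X4
  - A X1 X3 * F X2 X4 - A X2 X4 * F X1 X3.

End TensorAlgebra.

(* All tensors below are given at [p] by their action on rows of components in
   the chart [a]; they are meaningful when [dom a p]. *)
Section Curvature.
Context {R : realType} {n : nat} {M : manifold R n}.
Local Notation V := 'rV[R]_n.
Variable g : metric M.
Implicit Types (a : chart M) (p : M).

Definition gten a p (X Y : V) : R := ip (g a p) X Y.

Definition riemannian : Prop :=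
  forall a p, dom a p -> forall X : V, X != 0 -> 0 < gten a p X X.

(* Christoffel symbols of the Levi-Civita connection: nabla_i d_j is the sum
   over k of (christoffel a i j k) d_k *)
Definition christoffel a (i j k : 'I_n) (p : M) : R :=
  2^-1 * \sum_l invmx (g a p) k l *
    (pd a i (fun q => g a q j l) p + pd a j (fun q => g a q i l) p
     - pd a l (fun q => g a q i j) p).

(* l-th component of
   nabla_i nabla_j d_k - nabla_j nabla_i d_k, the curvature R(d_i, d_j)d_k *)
Definition riem_coef a (i j k l : 'I_n) (p : M) : R :=
  pd a i (christoffel a j k l) p - pd a j (christoffel a i k l) p
  + \sum_m (christoffel a j k m p * christoffel a i m l p
            - christoffel a i k m p * christoffel a j m l p).

Definition riem13 a p (X Y Z : V) : V :=
  \row_l \sum_i \sum_j \sum_k X 0 i * Y 0 j * Z 0 k * riem_coef a i j k l p.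

Definition riem a p (X1 X2 X3 X4 : V) : R := gten a p (riem13 a p X1 X2 X3) X4.

Definition ric a p (X2 X3 : V) : R :=
  contract (g a p) (fun X1 X4 => riem a p X1 X2 X3 X4).

Definition ric_op a p (X : V) : V := sharp (g a p) (ric a p X).

Definition scal a p : R := contract (g a p) (ric a p).

Definition ric2 a p (X Y : V) : R := gten a p (ric_op a p (ric_op a p X)) Y.

Definition scal2 a p : R := \tr (lin1_mx (fun X => ric_op a p (ric_op a p X))).

Definition Etensor a p (X Y : V) : R :=
  contract (g a p) (fun X1 X2 => riem a p X1 X Y (ric_op a p X2)).

Definition projective a p (X1 X2 X3 X4 : V) : R :=
  riem a p X1 X2 X3 X4
  - (n%:R - 1)^-1 * (ric a p X2 X3 * gten a p X1 X4
                     - ric a p X1 X3 * gten a p X2 X4).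

Definition einstein : Prop :=
  forall a p, dom a p -> forall X Y : V,
    ric a p X Y = scal a p / n%:R * gten a p X Y.

End Curvature.

(* Main.v *)
(** At a point, write [S] for the Ricci tensor, [Q] for the Ricci operator and
    [k] for the scalar curvature.  Tracing [P.R = L Q(g, R)] over the first slot
    and the value gives [P.S = L Q(g, S)], and [P.S = R.S] because [S] is
    annihilated by the endomorphisms [X /\_S Y].

    The endomorphism [P(X, Y)] is not skew for [g].  Pairing the hypothesis with
    [X4] and symmetrising in [X3], [X4] kills everything except this defect,
    which is a multiple of [Q(S, g)]: every curvature operator [R(X1, X2)]
    annihilates [Q(S, g)] in its first two arguments ([rm_ricci_metric]).
    Tracing this identity over one pair of slots gives [R.S = 0], hence
    [L Q(g, S) = 0], and [n R(X1, X2, X3, Q X4) = k R(X1, X2, X3, X4)].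
    Tracing over another pair gives
    [S^2(X1, Y) g(X, W) - S^2(X1, X) g(Y, W) + S(Y, W) S(X1, X)
     - S(X, W) S(X1, Y) = 0],
    from which (ii), (iii) and the second alternative of (iv) follow.  In
    particular [P.Q] and [L Q(g, Q)] both vanish, so both sides of the
    equivalence in (iv) always hold.

    The symmetries of [R] that are used come from the coordinate expression of
    the lowered curvature, in which second derivatives of the metric commute. *)
From HB Require Import structures.
Require Import Defs.
From mathcomp Require Import all_boot all_order all_algebra.
From mathcomp Require Import all_classical all_reals all_analysis.
From mathcomp Require Import ring lra.
Import Order.TTheory GRing.Theory Num.Theory.
Import numFieldNormedType.Exports.
Local Open Scope classical_set_scope.
Local Open Scope ring_scope.

(* Otherwise shadowed by [constructive_ereal.contract] and [vector.coord]. *)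
Local Notation contract := Defs.contract.
Local Notation coord := Defs.coord.

(** * Contractions *)

Section Contraction.
Context {R : realType} {n : nat} (G : 'M[R]_n).
Local Notation V := 'rV[R]_n.
Hypotheses (G_sym : G^T = G) (G_unit : G \in unitmx).

Lemma scalar_sum (w : V -> R) (X : V) :
  scalar w -> w X = \sum_i X 0 i * w (evec i).
Proof.
move=> hw; pose w' : {linear V -> R | *%R} :=
  HB.pack w (GRing.isLinear.Build R V R *%R w hw).
rewrite [X in LHS]row_sum_delta -[w]/(w' : V -> R) linear_sum.
by apply: eq_bigr => i _; rewrite linearZ.
Qed.

Lemma scalar_comb (w : V -> R) (a b : R) (X Y : V) :
  scalar w -> w (a *: X - b *: Y) = a * w X - b * w Y.
Proof.
move=> hw; pose w' : {linear V -> R | *%R} :=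
  HB.pack w (GRing.isLinear.Build R V R *%R w hw).
by rewrite -[w]/(w' : V -> R) linearB !linearZ.
Qed.

Lemma scalar_ext (w w' : V -> R) (X : V) : scalar w -> scalar w' ->
  (forall i, w (evec i) = w' (evec i)) -> w X = w' X.
Proof.
move=> hw hw' e; rewrite (scalar_sum w) // (scalar_sum w') //.
by apply: eq_bigr => i _; rewrite e.
Qed.

Lemma scalarN (w : V -> R) : scalar w -> scalar (fun X => - w X).
Proof. by move=> hw t X Y; rewrite hw /=; ring. Qed.

Lemma ipC (X Y : V) : ip G X Y = ip G Y X.
Proof.
have e : Y *m G *m X^T = (X *m G *m Y^T)^T.
  by rewrite !trmx_mul trmxK G_sym mulmxA.
by rewrite /ip e [RHS]mxE.
Qed.

Lemma ipPl (Y : V) : scalar (fun X => ip G X Y).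
Proof. by move=> a U W; rewrite /ip !mulmxDl -!scalemxAl !mxE. Qed.

Lemma ipPr (X : V) : scalar (ip G X).
Proof. by move=> a U W; rewrite !(ipC X) ipPl. Qed.

Lemma ipDl (X X' Y : V) : ip G (X + X') Y = ip G X Y + ip G X' Y.
Proof. by rewrite /ip !mulmxDl !mxE. Qed.

Lemma ipZl (a : R) (X Y : V) : ip G (a *: X) Y = a * ip G X Y.
Proof. by rewrite /ip -!scalemxAl !mxE. Qed.

Lemma ipNl (X Y : V) : ip G (- X) Y = - ip G X Y.
Proof. by rewrite -scaleN1r ipZl mulN1r. Qed.

Definition ipE := (ipDl, ipNl, ipZl).

(** The rows of [invmx G] are the basis dual to the coordinate basis, so pairing with them reads off
    components. Nondegeneracy ([ip_inj]) follows, and vector identities below are proved by pairing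
    with an arbitrary vector. *)
Lemma ip_evec (X : V) (i : 'I_n) : ip G X (row i (invmx G)) = X 0 i.
Proof.
have hG : (invmx G)^T = invmx G by rewrite trmx_inv G_sym.
rewrite /ip tr_row hG -!mulmxA -[col i _]mulmx1.
have -> : G *m (col i (invmx G) *m 1%:M) = col i 1%:M.
  by rewrite mulmx1 colE mulmxA mulmxV // mul1mx colE mul1mx.
by rewrite colE mul1mx -colE !mxE.
Qed.

Lemma ip_inj (X X' : V) : (forall Y, ip G X Y = ip G X' Y) -> X = X'.
Proof. by move=> h; apply/rowP => i; rewrite -!ip_evec. Qed.

Lemma ip_sharp (w : V -> R) (X : V) : scalar w -> ip G (sharp G w) X = w X.
Proof.
move=> hw; rewrite /ip /sharp mulmxKV // (scalar_sum w X hw) mxE.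
by apply: eq_bigr => i _; rewrite !mxE mulrC.
Qed.

Lemma sharp_ip (X : V) : sharp G (ip G X) = X.
Proof. by apply: ip_inj => Y; rewrite ip_sharp //; exact: ipPr. Qed.

Lemma eq_contract (A B : V -> V -> R) :
  (forall X Y, A X Y = B X Y) -> contract G A = contract G B.
Proof.
by move=> h; apply: eq_bigr => i _; apply: eq_bigr => j _; rewrite h.
Qed.

Lemma contractD (A B : V -> V -> R) :
  contract G (fun X Y => A X Y + B X Y) = contract G A + contract G B.
Proof.
rewrite /contract -big_split; apply: eq_bigr => i _ /=.
by rewrite -big_split; apply: eq_bigr => j _ /=; rewrite mulrDr.
Qed.

Lemma contractZ (k : R) (A : V -> V -> R) :
  contract G (fun X Y => k * A X Y) = k * contract G A.
Proof.
rewrite /contract mulr_sumr; apply: eq_bigr => i _.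
by rewrite mulr_sumr; apply: eq_bigr => j _; rewrite mulrCA.
Qed.

Lemma contractZr (k : R) (A : V -> V -> R) :
  contract G (fun X Y => A X Y * k) = contract G A * k.
Proof.
by rewrite mulrC -contractZ; apply: eq_contract => X Y; rewrite mulrC.
Qed.

Lemma contract0 (A : V -> V -> R) :
  (forall X Y, A X Y = 0) -> contract G A = 0.
Proof.
by move=> h; apply: big1 => i _; apply: big1 => j _; rewrite h mulr0.
Qed.

Lemma contractN (A : V -> V -> R) :
  contract G (fun X Y => - A X Y) = - contract G A.
Proof.
by rewrite -mulN1r -contractZ; apply: eq_contract => X Y; rewrite mulN1r.
Qed.

Lemma contractB (A B : V -> V -> R) :
  contract G (fun X Y => A X Y - B X Y) = contract G A - contract G B.
Proof. by rewrite (contractD A (fun X Y => - B X Y)) contractN. Qed.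

Lemma contract_swap (A : V -> V -> R) :
  contract G (fun X Y => A Y X) = contract G A.
Proof.
have hG i j : invmx G i j = invmx G j i.
  by rewrite -[in RHS](trmxK (invmx G)) trmx_inv G_sym mxE.
rewrite /contract exchange_big; apply: eq_bigr => i _.
by apply: eq_bigr => j _; rewrite hG.
Qed.

Lemma contract_alternating (A : V -> V -> R) :
  (forall X Y, A X Y = - A Y X) -> contract G A = 0.
Proof.
move=> h; have : contract G A = - contract G A.
  by rewrite -{1}(contract_swap A) -contractN; apply: eq_contract => X Y.
lra.
Qed.

Lemma contract_dual (A : V -> V -> R) : (forall X, scalar (A X)) ->
  contract G A = \sum_i A (evec i) (row i (invmx G)).
Proof.
move=> hA; apply: eq_bigr => i _; rewrite (scalar_sum _ _ (hA _)).
by apply: eq_bigr => j _; rewrite mxE.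
Qed.

(** Lowering an index of an endomorphism and then contracting undoes itself, so the metric
    contraction is the ordinary trace. *)
Lemma contract_endo (T : V -> V) :
  contract G (fun X Y => ip G (T X) Y) = \sum_i T (evec i) 0 i.
Proof.
rewrite contract_dual; last by move=> X; exact: ipPr.
by apply: eq_bigr => i _; rewrite ip_evec.
Qed.

Lemma contract_endo_tr (T : V -> V) :
  contract G (fun X Y => ip G (T X) Y) = \tr (lin1_mx T).
Proof. by rewrite contract_endo; apply: eq_bigr => i _; rewrite mxE. Qed.

Lemma lin1_mxE (T : V -> V) (X : V) : linear T -> T X = X *m lin1_mx T.
Proof.
move=> hT; pose T' : {linear V -> V} :=
  HB.pack T (GRing.isLinear.Build R V V *:%R T hT).
by rewrite -[T]/(T' : V -> V) mul_rV_lin1.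
Qed.

(** Cyclicity of the trace. Matrices act on rows from the right, which is why the product in
    [tr_comp] appears in reverse order. *)
Lemma contract_endoC (T U : V -> V) : linear T -> linear U ->
  contract G (fun X Y => ip G (T (U X)) Y)
  = contract G (fun X Y => ip G (U (T X)) Y).
Proof.
move=> hT hU; have tr_comp (T1 T2 : V -> V) : linear T1 -> linear T2 ->
    contract G (fun X Y => ip G (T1 (T2 X)) Y)
    = \tr (lin1_mx T2 *m lin1_mx T1).
  move=> h1 h2; rewrite (contract_endo (fun X => T1 (T2 X))) /mxtrace.
  apply: eq_bigr => i _; rewrite (lin1_mxE _ _ h1) (lin1_mxE _ _ h2).
  by rewrite -mulmxA /evec -rowE mxE.
by rewrite !tr_comp // mxtrace_mulC.
Qed.

(** Contracting against the metric substitutes [Z] for the dummy vector; all traces of the main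
    identity are evaluated this way. *)
Lemma contract_ip (w : V -> R) (Z : V) : scalar w ->
  contract G (fun X Y => w X * ip G Z Y) = w Z.
Proof.
move=> hw; rewrite contract_dual => [|X a U W]; last by rewrite ipPr /=; ring.
rewrite (scalar_sum _ _ hw); apply: eq_bigr => i _.
by rewrite ip_evec mulrC.
Qed.

Lemma contract_ip_swap (w : V -> R) (Z : V) : scalar w ->
  contract G (fun X Y => w Y * ip G X Z) = w Z.
Proof.
move=> hw; rewrite -(contract_ip w Z hw) -[RHS]contract_swap.
by apply: eq_contract => X Y; rewrite (ipC X).
Qed.

Lemma contract_ip_dim : contract G (ip G) = n%:R.
Proof.
rewrite (contract_endo id) (eq_bigr (fun=> 1)) => [|i _].
  by rewrite sumr_const card_ord.
by rewrite mxE !eqxx.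
Qed.

End Contraction.

(** * Algebra of the curvature tensor at a point *)

Section CurvatureTensor.
Context {R : realType} {n : nat} (G : 'M[R]_n).
Local Notation V := 'rV[R]_n.
Variable rm : V -> V -> V -> V.

(** This and the next two definitions restate [ric], [ric_op] and [projective] for an abstract [rm].
    With [riem13] in place of [rm] they are convertible to the originals, so the purely algebraic
    lemmas apply to the manifold directly. *)
Definition ricci_of (X2 X3 : V) : R :=
  contract G (fun X1 X4 => ip G (rm X1 X2 X3) X4).

Definition ricop_of (X : V) : V := sharp G (ricci_of X).

Definition proj_of (X1 X2 X3 X4 : V) : R :=
  ip G (rm X1 X2 X3) X4
  - (n%:R - 1)^-1 * (ricci_of X2 X3 * ip G X1 X4 - ricci_of X1 X3 * ip G X2 X4).

Hypotheses (G_sym : G^T = G) (G_unit : G \in unitmx) (n_ge3 : (3 <= n)%N).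
Hypotheses (rm1 : forall Y Z, linear (fun X => rm X Y Z))
  (rm2 : forall X Z, linear (fun Y => rm X Y Z))
  (rm3 : forall X Y, linear (rm X Y)).
Hypotheses
  (rm_skew : forall X Y Z W, ip G (rm X Y Z) W = - ip G (rm X Y W) Z)
  (rm_pair : forall X Y Z W, ip G (rm X Y Z) W = ip G (rm Z W X) Y).

Local Notation S := ricci_of.
Local Notation Q := ricop_of.

Lemma rm_alt (X Y Z : V) : rm X Y Z = - rm Y X Z.
Proof.
apply: (ip_inj G G_sym G_unit) => W.
by rewrite ipNl rm_pair rm_skew -rm_pair.
Qed.

Lemma ricC (X Y : V) : S X Y = S Y X.
Proof.
rewrite /ricci_of -(contract_swap G G_sym); apply: eq_contract => U W.
by rewrite rm_pair rm_alt ipNl rm_skew opprK.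
Qed.

Lemma ricPr (X : V) : scalar (S X).
Proof.
move=> a U W; rewrite /ricci_of -contractZ -contractD.
by apply: eq_contract => Y Z; rewrite rm3 ipDl ipZl.
Qed.

Lemma ricPl (Y : V) : scalar (fun X => S X Y).
Proof. by move=> a U W; rewrite !(ricC _ Y) ricPr. Qed.

Lemma ip_ricop (X Y : V) : ip G (Q X) Y = S X Y.
Proof. by rewrite ip_sharp //; exact: ricPr. Qed.

Lemma ricopP : linear Q.
Proof.
move=> a U W; apply: (ip_inj G G_sym G_unit) => Y.
by rewrite ipDl ipZl !ip_ricop ricPl.
Qed.

(** Both sides are the metric pairing of [Q X] with [Q Y]. *)
Lemma ric_ricopC (X Y : V) : S (Q X) Y = S X (Q Y).
Proof. by rewrite ricC -!ip_ricop (ipC G G_sym). Qed.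

Lemma assoc13_rm (X Y Z : V) :
  assoc13 G (fun X Y Z => ip G (rm X Y Z)) X Y Z = rm X Y Z.
Proof. exact: sharp_ip. Qed.

Local Notation c := ((n%:R - 1 : R)^-1).

(** Separates the projective operator into a part that is skew for the metric and a multiple of the
    wedge with [S], the only source of the skewness defect. *)
Lemma assoc13_proj (X Y Z : V) :
  assoc13 G proj_of X Y Z = rm X Y Z - c *: wedge_end S X Y Z.
Proof.
apply: (ip_inj G G_sym G_unit) => W; rewrite ip_sharp //; last first.
  by move=> a U U'; rewrite /proj_of !(ipPr G G_sym) /=; ring.
by rewrite /proj_of /wedge_end !ipE; ring.
Qed.

(** The action of an endomorphism commutes with the trace: the terms where [l] hits the value and
    where it hits the first slot cancel by cyclicity. *)
Lemma contract_act13 (l : V -> V) (X2 X3 : V) : linear l ->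
  contract G (fun X1 X4 => ip G (act13 l rm X1 X2 X3) X4) = act02 l S X2 X3.
Proof.
move=> hl; rewrite /act13 /act02.
under eq_contract => X1 X4 do rewrite !ipE.
rewrite contractB !contractD.
rewrite (contract_endoC G G_sym G_unit l (fun X => rm X X2 X3) hl (rm1 _ _)).
by rewrite /ricci_of; ring.
Qed.

Lemma wedge_endP (A : V -> V -> R) (X Y : V) :
  (forall Z, scalar (A Z)) -> linear (wedge_end A X Y).
Proof.
move=> hA a U W; apply/rowP => i; rewrite /wedge_end !hA !mxE /=; ring.
Qed.

Lemma assoc13_projP (X Y : V) : linear (assoc13 G proj_of X Y).
Proof.
move=> a U W; rewrite !assoc13_proj (wedge_endP _ _ _ ricPr) rm3.
by apply/rowP => i; rewrite !mxE; ring.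
Qed.

(** * Consequences of the pseudosymmetry condition at a point *)

Variable L : R.
Hypothesis projective_pseudosymmetric : forall X1 X2 X3 X Y : V,
  dot13 G proj_of rm X1 X2 X3 X Y = L *: Q13 (ip G) rm X1 X2 X3 X Y.

Lemma dot02_proj_ric (X1 X2 X Y : V) :
  dot02 G proj_of S X1 X2 X Y = L * Q02 (ip G) S X1 X2 X Y.
Proof.
rewrite /dot02 /Q02 -!contract_act13.
- rewrite -contractZ; apply: eq_contract => U W.
  by rewrite -ipZl; congr (ip G _ _); exact: projective_pseudosymmetric.
- by apply: wedge_endP; exact: ipPr.
- exact: assoc13_projP.
Qed.

(** The endomorphism [wedge_end A X Y] is skew for [A]. This is used with [A] the Ricci tensor, for
    P.S = R.S, and with [A] the metric. *)
Lemma act02_wedge_self (A : V -> V -> R) (X Y U W : V) :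
  (forall Z Z', A Z Z' = A Z' Z) -> (forall Z, scalar (A Z)) ->
  act02 (wedge_end A X Y) A U W = 0.
Proof.
move=> AC hA; rewrite /act02 /wedge_end (AC _ W) !(scalar_comb _ _ _ _ _ (hA _)).
by rewrite !(AC W) !(AC U); ring.
Qed.

Lemma act02_proj (X Y U W : V) (A : V -> V -> R) :
  (forall Z Z', A Z Z' = A Z' Z) -> (forall Z, scalar (A Z)) ->
  act02 (assoc13 G proj_of X Y) A U W
  = act02 (rm X Y) A U W - c * act02 (wedge_end S X Y) A U W.
Proof.
move=> AC hA; rewrite /act02 !assoc13_proj.
rewrite (AC (_ - _) W) (AC (wedge_end _ _ _ _) W) (AC (rm _ _ _) W).
rewrite -[rm X Y U]scale1r -[rm X Y W]scale1r !(scalar_comb _ _ _ _ _ (hA _)).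
by rewrite !scale1r; ring.
Qed.

Lemma dot02_rm_ric (X1 X2 X Y : V) :
  dot02 G (fun X Y Z => ip G (rm X Y Z)) S X1 X2 X Y
  = dot02 G proj_of S X1 X2 X Y.
Proof.
rewrite /dot02 act02_proj ?act02_wedge_self ?mulr0 ?subr0 //;
  try by [exact: ricC | exact: ricPr].
by rewrite /act02 !assoc13_rm.
Qed.

Local Notation B := (fun (l : V -> V) U W => ip G (l U) W + ip G U (l W)).

(** [B l] is the defect of skewness of [l]. Under symmetrisation the terms with [l X1] and [l X2]
    cancel because [rm] is skew in its last pair, and the same skewness turns the terms with [l X3]
    and [l X4] into the missing halves of [B]. *)
Lemma act13_skew (l : V -> V) (X1 X2 X3 X4 : V) :
  ip G (act13 l rm X1 X2 X3) X4 + ip G (act13 l rm X1 X2 X4) X3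
  = B l (rm X1 X2 X3) X4 + B l X3 (rm X1 X2 X4).
Proof.
rewrite /act13 !ipE (rm_skew _ _ (l X3)) (rm_skew _ _ (l X4)).
rewrite (rm_skew (l X1)) (rm_skew X1 (l X2)).
by rewrite (ipC G G_sym (l X3)) (ipC G G_sym X3); ring.
Qed.

Lemma rm_ricci_metric (X1 X2 X Y U W : V) :
  S Y (rm X1 X2 U) * ip G X W - S X (rm X1 X2 U) * ip G Y W
  + S Y W * ip G X (rm X1 X2 U) - S X W * ip G Y (rm X1 X2 U)
  + S Y U * ip G X (rm X1 X2 W) - S X U * ip G Y (rm X1 X2 W)
  + S Y (rm X1 X2 W) * ip G X U - S X (rm X1 X2 W) * ip G Y U = 0.
Proof.
have BE l A A' : B l A A' = - act02 l (ip G) A A' by rewrite /act02 opprK.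
have wedge0 A A' : act02 (wedge_end (ip G) X Y) (ip G) A A' = 0.
  by apply: act02_wedge_self; [exact: ipC | exact: ipPr].
have rm0 A A' : act02 (rm X Y) (ip G) A A' = 0.
  by rewrite /act02 (ipC G G_sym A) (rm_skew X Y A) addNr oppr0.
have := act13_skew (assoc13 G proj_of X Y) X1 X2 U W.
have hL A : act13 (assoc13 G proj_of X Y) rm X1 X2 A
    = L *: act13 (wedge_end (ip G) X Y) rm X1 X2 A.
  exact: projective_pseudosymmetric.
(* The projective side has become [L] times the defect of the metric wedge, which is zero; the
   defect of the projective operator therefore vanishes too. *)
rewrite !hL !ipZl -mulrDr act13_skew !BE !wedge0 !oppr0 addr0 mulr0.
rewrite !act02_proj ?rm0 //; try by [exact: ipC | exact: ipPr].
(* Only the wedge with [S] contributes to that defect, so the inverse of n - 1 factors out; it is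
   nonzero because n >= 3. *)
move=> /esym/eqP; rewrite !sub0r !opprK -mulrDr mulf_eq0 invr_eq0.
have -> : (n%:R - 1 : R) == 0 = false.
  by rewrite subr_eq0 pnatr_eq1; case: n n_ge3 => [|[]].
move=> /= /eqP; rewrite /act02 /wedge_end !(scalar_comb _ _ _ _ _ (ipPr G G_sym _)).
rewrite !(scalar_comb (fun Z => ip G Z _) _ _ _ _ (ipPl G _)).
rewrite !(ipC G G_sym _ X) !(ipC G G_sym _ Y) => h; rewrite -[RHS]oppr0 -{}h.
by ring.
Qed.

(** The trace of a self-adjoint endomorphism composed with a skew one equals its own negative. *)
Lemma contract_ric_rm (X1 X2 : V) :
  contract G (fun X Y => S X (rm X1 X2 Y)) = 0.
Proof.
have e : contract G (fun X Y => S X (rm X1 X2 Y))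
    = - contract G (fun X Y => S X (rm X1 X2 Y)).
  rewrite -{2}(contract_swap G G_sym) -contractN.
  transitivity (contract G (fun X Y => - ip G (rm X1 X2 (Q X)) Y)).
    apply: eq_contract => X Y.
    by rewrite -ip_ricop (ipC G G_sym) rm_skew.
  rewrite !contractN (contract_endoC G G_sym G_unit _ Q) //; last exact: ricopP.
  by congr (- _); apply: eq_contract => X Y; rewrite ip_ricop ricC.
lra.
Qed.

Local Notation kappa := (contract G S).

Lemma contract_rm (X1 X2 : V) :
  contract G (fun X Y => ip G X (rm X1 X2 Y)) = 0.
Proof.
apply: (contract_alternating G G_sym) => X Y.
by rewrite (ipC G G_sym X) rm_skew (ipC G G_sym Y).
Qed.

Lemma contract_rm23 (X1 Z : V) :
  contract G (fun X2 U => ip G Z (rm X1 X2 U)) = S X1 Z.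
Proof.
apply: eq_contract => X2 U.
by rewrite (ipC G G_sym) rm_alt ipNl rm_skew opprK.
Qed.

Lemma rm_scalar3 (w : V -> R) (X Y : V) :
  scalar w -> scalar (fun Z => w (rm X Y Z)).
Proof. by move=> hw a U W; rewrite rm3 hw. Qed.

Lemma rm_scalar2 (w : V -> R) (X Z : V) :
  scalar w -> scalar (fun Y => w (rm X Y Z)).
Proof. by move=> hw a U W; rewrite rm2 hw. Qed.

(** The contraction of [rm_ricci_metric] over [X] and [W]. Its part symmetric in [U], [Y] yields
    [rm_ric], and what is then left yields [ric_rm]. *)
Lemma ric_rm_sum (X1 X2 U Y : V) :
  n%:R * S Y (rm X1 X2 U) + S Y (rm X1 X2 U) + S (rm X1 X2 Y) U
  - kappa * ip G Y (rm X1 X2 U) = 0.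
Proof.
have := contract0 G _ (fun X W => rm_ricci_metric X1 X2 X Y U W).
rewrite !(contractD, contractN) !contractZ contract_ip_dim //.
rewrite !contractZr contract_rm contract_ric_rm !contract_ip //; last exact: ricPl.
rewrite !contract_ip_swap //; last 2 first.
- exact: (rm_scalar3 _ _ _ (ricPr _)).
- exact: ricPr.
have -> : contract G (fun X W => S X U * ip G Y (rm X1 X2 W)) = - S (rm X1 X2 Y) U.
  transitivity (contract G (fun X W => - (S X U * ip G (rm X1 X2 Y) W))).
    by apply: eq_contract => X W; rewrite (ipC G G_sym Y) rm_skew mulrN.
  by rewrite contractN contract_ip //; exact: ricPl.
by move=> h; rewrite -[RHS]h; ring.
Qed.

(** Adding [ric_rm_sum] to itself with [U] and [Y] exchanged cancels the [kappa] terms by skewness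
    and leaves n + 2 times this expression. *)
Lemma rm_ric (X1 X2 U Y : V) : S (rm X1 X2 U) Y + S U (rm X1 X2 Y) = 0.
Proof.
have h1 := ric_rm_sum X1 X2 U Y; have h2 := ric_rm_sum X1 X2 Y U.
have hs : ip G Y (rm X1 X2 U) = - ip G U (rm X1 X2 Y).
  by rewrite (ipC G G_sym) rm_skew (ipC G G_sym U).
have n2 : (n%:R + 2 : R) != 0 by rewrite -natrD pnatr_eq0 addn2.
apply: (mulfI n2); move: h1 h2; rewrite hs !(ricC (rm _ _ _)) => h1 h2.
by rewrite mulr0 -[RHS](addr0 0) -{1}h1 -h2; ring.
Qed.

Lemma ric_rm (X1 X2 U Y : V) :
  n%:R * S Y (rm X1 X2 U) = kappa * ip G Y (rm X1 X2 U).
Proof.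
have h := ric_rm_sum X1 X2 U Y; have h' := rm_ric X1 X2 U Y.
rewrite ricC in h'.
have e : S (rm X1 X2 Y) U = - S Y (rm X1 X2 U).
  by rewrite ricC; apply/eqP; rewrite -addr_eq0 addrC h'.
by apply/eqP; rewrite -subr_eq0 -h e; apply/eqP; ring.
Qed.

(** Contracting [ric_rm] over the second and third curvature slots turns curvature into the Ricci
    tensor on both sides. *)
Lemma ric_sq (X Y : V) : n%:R * S X (Q Y) = kappa * S X Y.
Proof.
rewrite -(contract_rm23 X Y) -contractZ -(contract_rm23 X (Q Y)) -contractZ.
by apply: eq_contract => X2 U; rewrite ip_ricop ric_rm.
Qed.

Let n_neq0 : (n%:R : R) != 0.
Proof. by rewrite pnatr_eq0; case: n n_ge3. Qed.

(** The contraction of [rm_ricci_metric] over [X2] and [U]; it is the common source of (ii), (iii)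
    and (iv). *)
Lemma ric_wedge_ric (X1 X Y W : V) :
  S X1 (Q Y) * ip G X W - S X1 (Q X) * ip G Y W
  + S Y W * S X1 X - S X W * S X1 Y = 0.
Proof.
have := contract0 G _ (fun X2 U => rm_ricci_metric X1 X2 X Y U W).
have h5 A A' : contract G (fun X2 U => S A U * ip G A' (rm X1 X2 W))
    = S A (rm W A' X1).
  rewrite -(contract_ip_swap G G_sym G_unit _ _ (ricPr A)).
  by apply: eq_contract => X2 U; rewrite (ipC G G_sym A') rm_pair (ipC G G_sym X2).
have h7 A A' : contract G (fun X2 U => S A (rm X1 X2 W) * ip G A' U)
    = S A (rm X1 A' W).
  by rewrite (contract_ip _ G_sym G_unit _ _ (rm_scalar2 _ _ _ (ricPr A))).
have h1 A : contract G (fun X2 U => S A (rm X1 X2 U)) = S X1 (Q A).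
  by rewrite -contract_rm23; apply: eq_contract => X2 U; rewrite ip_ricop.
rewrite !(contractD, contractN) !h5 !h7 !contractZr !contractZ !h1 !contract_rm23.
(* Four terms still contain curvature. By [ric_rm] each is kappa / n times a curvature component,
   and pair symmetry makes them cancel two by two. *)
have h A A' A'' Z : S A (rm A' A'' Z) = kappa / n%:R * ip G A (rm A' A'' Z).
  by apply: (mulfI n_neq0); rewrite ric_rm; field.
rewrite !h (ipC G G_sym Y (rm W X X1)) (ipC G G_sym X (rm W Y X1)).
rewrite rm_pair (rm_pair W Y) !(ipC G G_sym (rm X1 _ W)) => e.
by rewrite -[RHS]e; ring.
Qed.

(** Contracting [ric_wedge_ric] over [X1] and [Y] cancels its two middle terms, while [ric_sq] gives
    kappa^2 / n for the trace of S^2. *)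
Lemma scal_sq_ip (X W : V) : kappa ^+ 2 * ip G X W = n%:R * kappa * S X W.
Proof.
have := contract0 G _ (fun X1 Y => ric_wedge_ric X1 X Y W).
rewrite !(contractD, contractN) !contractZr !contractZ.
have -> : contract G (fun X1 Y => S X1 (Q X) * ip G Y W) = S W (Q X).
  rewrite -(contract_ip _ G_sym G_unit _ _ (ricPl (Q X))).
  by apply: eq_contract => X1 Y; rewrite (ipC G G_sym W).
have -> : contract G (fun X1 Y => S Y W * S X1 X) = S (Q X) W.
  rewrite -(contract_ip_swap _ G_sym G_unit _ _ (ricPl W)).
  apply: eq_contract => X1 Y.
  by rewrite (ipC G G_sym X1) ip_ricop (ricC X).
have -> : contract G (fun X1 Y => S X1 (Q Y)) = kappa / n%:R * kappa.
  rewrite -contractZ; apply: eq_contract => X1 Y.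
  by apply: (mulfI n_neq0); rewrite ric_sq; field.
rewrite (ricC W) => h; apply/eqP; rewrite -subr_eq0 -(mulr0 n%:R) -h.
by apply/eqP; field.
Qed.

(** The outer terms each equal n kappa S, by [ric_sq] and [scal_sq_ip]. *)
Lemma ric_quadratic (X Y : V) :
  n%:R ^+ 2 * S X (Q Y) - 2 * n%:R * kappa * S X Y + kappa ^+ 2 * ip G X Y = 0.
Proof. by rewrite expr2 -mulrA ric_sq scal_sq_ip; ring. Qed.

(** * Vanishing of the terms with [L], and the pointwise conclusions *)

Lemma L_Q02_ric (X1 X2 X Y : V) : L * Q02 (ip G) S X1 X2 X Y = 0.
Proof.
rewrite -dot02_proj_ric -dot02_rm_ric /dot02 /act02 !assoc13_rm.
by rewrite rm_ric oppr0.
Qed.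

(** The trace of [L_Q02_ric] over [X1] and the last argument. It makes the two [L] terms in the
    formula for E cancel. *)
Lemma L_traceless_ric (X Y : V) :
  L * kappa * ip G X Y = L * n%:R * S X Y.
Proof.
have := contract0 G _ (fun X1 Z => L_Q02_ric X1 Y X Z).
have -> : (fun X1 Z => L * Q02 (ip G) S X1 Y X Z) = fun X1 Z =>
    L * (S Y Z * ip G X X1 - S X Y * ip G X1 Z
         + S X1 Z * ip G X Y - S X1 X * ip G Y Z).
  apply: funext => X1; apply: funext => Z.
  rewrite /Q02 /act02 /wedge_end (scalar_comb (fun U => S U Y) _ _ _ _ (ricPl Y)).
  rewrite (scalar_comb _ _ _ _ _ (ricPr _)) (ricC Z) (ipC G G_sym Z X1).
  by rewrite (ipC G G_sym Z Y); ring.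
rewrite contractZ !(contractD, contractN) !contractZr contractZ contract_ip_dim //.
have -> : contract G (fun X1 Z => S Y Z * ip G X X1) = S Y X.
  rewrite -(contract_ip_swap _ G_sym G_unit _ _ (ricPr Y)).
  by apply: eq_contract => X1 Z; rewrite (ipC G G_sym X).
rewrite (contract_ip _ G_sym G_unit _ _ (ricPl X)) (ricC Y) => h.
by apply/eqP; rewrite -subr_eq0 -h; apply/eqP; ring.
Qed.

(** As the projective operator is not skew, this is more than P.S = 0 with an index raised: the
    curvature part vanishes by [rm_ric], the wedge part by [ric_wedge_ric]. *)
Lemma dot11_proj_ricop (X1 X Y : V) : dot11 G proj_of Q X1 X Y = 0.
Proof.
apply: (ip_inj G G_sym G_unit) => W.
rewrite /dot11 /act11 ipDl ipNl ip_ricop !assoc13_proj !ipE.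
rewrite -[rm X Y X1]scale1r (scalar_comb (fun U => S U W) _ _ _ _ (ricPl W)).
rewrite /wedge_end (scalar_comb (fun U => S U W) _ _ _ _ (ricPl W)).
rewrite rm_skew (ipC G G_sym _ (Q X1)) ip_ricop -(scale0r (0 : V)) ipZl mul0r.
have e : S (rm X Y X1) W = - S X1 (rm X Y W).
  by apply/eqP; rewrite -addr_eq0 rm_ric.
rewrite e -(ric_ricopC Y X1) -(ric_ricopC X X1) !(ricC _ X1).
by rewrite -[RHS](mulr0 c) -(ric_wedge_ric X1 Y X W); ring.
Qed.

(** Here the wedge is skew for the metric, so pairing with [W] does reduce the claim to
    [L_Q02_ric]. *)
Lemma L_Q11_ricop (X1 X Y : V) : L *: Q11 (ip G) Q X1 X Y = 0.
Proof.
apply: (ip_inj G G_sym G_unit) => W.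
rewrite ipZl -[in RHS](scale0r (0 : V)) ipZl mul0r -(L_Q02_ric X1 W X Y).
rewrite /Q11 /act11 /Q02 /act02 ipDl ipNl ip_ricop; congr (_ * _).
rewrite /wedge_end !ipE (scalar_comb _ _ _ _ _ (ricPr _)).
by rewrite !(ipC G G_sym _ (Q X1)) !ip_ricop; ring.
Qed.

Lemma contract_rm_ricop (X Y : V) :
  contract G (fun X1 X2 => ip G (rm X1 X Y) (Q X2))
  = L * kappa * ip G X Y - L * n%:R * S X Y + S X (Q Y).
Proof.
rewrite L_traceless_ric subrr add0r; apply: (mulfI n_neq0).
rewrite ric_sq -!contractZ; apply: eq_contract => X1 X2.
by rewrite (ipC G G_sym) ip_ricop ric_rm (ipC G G_sym).
Qed.

Lemma ric_proportional (X Y : V) : (forall Z : V, Z != 0 -> 0 < ip G Z Z) ->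
  S X Y = kappa / n%:R * ip G X Y.
Proof.
(* The left side of [ric_quadratic] at [X], [X] is the squared length of [T], so definiteness forces
   [T] to vanish. *)
move=> pos; pose T := n%:R *: Q X - kappa *: X.
have T0 : T = 0.
  apply/eqP; apply: contraT => /pos; suff -> : ip G T T = 0 by rewrite ltxx.
  have e Z : ip G T Z = n%:R * S X Z - kappa * ip G X Z.
    by rewrite ipDl ipNl !ipZl ip_ricop.
  rewrite e (scalar_comb _ _ _ _ _ (ricPr _)).
  rewrite (scalar_comb _ _ _ _ _ (ipPr _ G_sym X)) (ipC G G_sym X (Q X)) ip_ricop.
  by rewrite -[RHS](ric_quadratic X X); ring.
apply: (mulfI n_neq0); apply/eqP; rewrite -subr_eq0.
have -> : n%:R * S X Y - n%:R * (kappa / n%:R * ip G X Y) = ip G T Y.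
  by rewrite ipDl ipNl !ipZl ip_ricop; field.
by rewrite T0 -[0 : V](scale0r 0) ipZl mul0r.
Qed.

Lemma tr_ricop_sq : \tr (lin1_mx (fun X => Q (Q X))) = kappa ^+ 2 / n%:R.
Proof.
rewrite -(contract_endo_tr G G_sym G_unit); apply: (mulfI n_neq0).
rewrite -contractZ [RHS](_ : _ = kappa * kappa); last by field.
rewrite -[RHS]contractZ; apply: eq_contract => X Y.
by rewrite ip_ricop ric_ricopC ric_sq.
Qed.

End CurvatureTensor.

(** * Mixed derivatives *)

Section MixedDerivatives.
Context {R : realType} {V : normedModType R}.
Implicit Types (f : V -> R) (v w x : V).

Lemma is_derive_line f x v (s : R) : derivable f (x + s *: v) v ->
  is_derive s 1 (fun r : R => f (x + r *: v)) ('D_v f (x + s *: v)).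
Proof.
have e : (fun h : R => h^-1 *: (((fun r : R => f (x + r *: v)) \o shift s)
      (h *: (1 : R)) - f (x + s *: v)))
    = (fun h : R => h^-1 *: ((f \o shift (x + s *: v)) (h *: v) - f (x + s *: v))).
  apply: funext => h /=; congr (_ *: (f _ - _)).
  by rewrite -[h *: 1]/(h * 1) mulr1 scalerDl addrCA.
move=> df; split; first by rewrite /derivable e.
by rewrite /derive e.
Qed.

Lemma mean_value_line f x v (t : R) : 0 < t ->
  (forall s, 0 <= s <= t -> derivable f (x + s *: v) v) ->
  exists2 s, 0 <= s <= t & f (x + t *: v) - f x = t * 'D_v f (x + s *: v).
Proof.
move=> t0 df.
have [|s /itvP hs||s] := @MVT_segment R (fun r => f (x + r *: v))
    (fun s => 'D_v f (x + s *: v)) 0 t.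
- exact: ltW.
- apply: is_derive_line; apply: df; rewrite !hs; lra.
- apply: derivable_within_continuous => s; rewrite in_itv /= => hs.
  by have [] := is_derive_line f x v s (df s hs).
- rewrite in_itv /= => hs e; exists s => //.
  by rewrite mulrC -[t in RHS]subr0 -e scale0r addr0.
Qed.

(** The mean value theorem is applied along [v] to the increment [F] of [f] by [t *: w], then along
    [w] to the [v]-derivative of [f]. *)
Lemma second_difference f x v w (t : R) : 0 < t ->
  (forall s s', 0 <= s <= t -> 0 <= s' <= t ->
    derivable f (x + s *: v + s' *: w) v /\
    derivable ('D_v f) (x + s *: v + s' *: w) w) ->
  exists s s', [/\ 0 <= s <= t, 0 <= s' <= t &
    f (x + t *: v + t *: w) - f (x + t *: v) - f (x + t *: w) + f x
    = t * (t * 'D_w ('D_v f) (x + s *: v + s' *: w))].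
Proof.
move=> t0 df; pose F y := f (y + t *: w) - f y.
have tt : 0 <= t <= t by rewrite ltW /=.
have t00 : 0 <= (0 : R) <= t by rewrite lexx ltW.
have dF s : 0 <= s <= t -> is_derive (x + s *: v) v F
    ('D_v f (x + s *: v + t *: w) - 'D_v f (x + s *: v)).
  move=> hs; have h1 := (df s t hs tt).1; have := (df s 0 hs t00).1.
  rewrite scale0r addr0 => h2.
  have h3 : is_derive (x + s *: v) v (fun y => f (y + t *: w))
      ('D_v f (x + s *: v + t *: w)).
    have e : (fun h : R => h^-1 *: (((fun y => f (y + t *: w)) \o
          shift (x + s *: v)) (h *: v) - f (x + s *: v + t *: w)))
        = (fun h : R => h^-1 *: ((f \o shift (x + s *: v + t *: w)) (h *: v)
            - f (x + s *: v + t *: w))).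
      by apply: funext => h /=; rewrite -(addrA (h *: v)).
    by split; [rewrite /derivable e; exact: h1 | rewrite /derive e].
  by apply: is_deriveB => //; exact: derivableP.
have [s hs] := mean_value_line F x v t t0
  (fun s hs => @ex_derive _ _ _ _ _ _ _ (dF s hs)).
rewrite (@derive_val _ _ _ _ _ _ _ (dF s hs)) => eF.
have [s' hs' eD] := mean_value_line ('D_v f) (x + s *: v) w t t0
  (fun s' hs' => (df s s' hs hs').2).
exists s, s'; split=> //; rewrite -eD -eF /F; ring.
Qed.

(** Schwarz's theorem: the second difference over a small parallelogram is symmetric in [v] and [w],
    and each order of differentiation computes it at a point near [x]. *)
Lemma derive_swap f x v w :
  (\forall y \near x, [/\ derivable f y v, derivable f y w,
     derivable ('D_v f) y w & derivable ('D_w f) y v]) ->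
  {for x, continuous ('D_w ('D_v f))} -> {for x, continuous ('D_v ('D_w f))} ->
  'D_w ('D_v f) x = 'D_v ('D_w f) x.
Proof.
move=> df cA cB; apply/eqP; rewrite -subr_eq0 -normr_le0.
apply/ler_addgt0Pr => e e0; rewrite add0r.
have e2 : 0 < e / 2 by rewrite divr_gt0.
have : \forall y \near x, [/\ derivable f y v, derivable f y w,
     derivable ('D_v f) y w & derivable ('D_w f) y v] /\
    (`|'D_w ('D_v f) x - 'D_w ('D_v f) y| < e / 2 /\
     `|'D_v ('D_w f) x - 'D_v ('D_w f) y| < e / 2).
  apply: (filterI df); apply: filterI.
  - exact: (@cvgr_dist_lt _ _ _ _ _ _ _ cA _ e2).
  - exact: (@cvgr_dist_lt _ _ _ _ _ _ _ cB _ e2).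
move=> /nbhs_normP[d /= d0 hd].
(* The summand 1 keeps [K] positive when both directions vanish; t K = d / 2 keeps the whole
   parallelogram inside the ball of radius [d]. *)
pose K := `|v| + `|w| + 1; pose t := d / 2 / K.
have K0 : 0 < K by rewrite ltr_wpDl // addr_ge0.
have t0 : 0 < t by rewrite !divr_gt0.
have near_x s s' : 0 <= s <= t -> 0 <= s' <= t ->
    ball_ Num.norm x d (x + s *: v + s' *: w).
  move=> /andP[s0 st] /andP[s'0 s't]; rewrite /ball_ /= -addrA opprD addNKr normrN.
  apply: le_lt_trans (ler_normD _ _) _; rewrite !normrZ !ger0_norm //.
  apply: (@le_lt_trans _ _ (t * K)).
    by rewrite /K !mulrDr mulr1 -[leLHS]addr0 !lerD ?ler_wpM2r // ltW.
  by rewrite /t divfK ?gt_eqF // ltr_pdivrMr // ltr_pMr // ltr1n.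
have [s [s' [hs hs' e1]]] := second_difference f x v w t t0 (fun s s' hs hs' =>
  let: conj (And4 a b c d) _ := hd _ (near_x s s' hs hs') in conj a c).
have [|r [r' [hr hr' e3]]] := second_difference f x w v t t0.
  move=> r r' hr hr'; rewrite addrAC.
  by case: (hd _ (near_x r' r hr' hr)) => -[_ b _ d'] _; exact: (conj b d').
have e4 : 'D_w ('D_v f) (x + s *: v + s' *: w)
    = 'D_v ('D_w f) (x + r *: w + r' *: v).
  do 2 apply: (mulfI (lt0r_neq0 t0)).
  apply: (etrans (esym e1)); apply: (etrans _ e3).
  by rewrite [in RHS](addrAC x); ring.
have [_ [+ _]] := hd _ (near_x s s' hs hs'); rewrite e4 => l1.
have := near_x r' r hr' hr; rewrite addrAC => /hd[_ [_ l2]].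
apply: (le_trans (ler_distD ('D_v ('D_w f) (x + r *: w + r' *: v)) _ _)).
rewrite [e]splitr; apply: lerD; first exact: ltW l1.
by rewrite distrC; exact: ltW l2.
Qed.

End MixedDerivatives.

(** * Curvature in coordinates *)

Section PointwiseDerivatives.
Context {R : realType} {V : normedModType R}.
Implicit Types (x v : V).

Lemma derivable_sumf (m : nat) (f : 'I_m -> V -> R) x v :
  (forall i, derivable (f i) x v) -> derivable (fun y => \sum_i f i y) x v.
Proof.
move=> df; have -> : (fun y => \sum_i f i y) = \sum_i f i.
  by apply: funext => y; rewrite fct_sumE.
exact: derivable_sum.
Qed.

Lemma derive_sumf (m : nat) (f : 'I_m -> V -> R) x v :
  (forall i, derivable (f i) x v) ->
  'D_v (fun y => \sum_i f i y) x = \sum_i 'D_v (f i) x.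
Proof.
move=> df; have -> : (fun y => \sum_i f i y) = \sum_i f i.
  by apply: funext => y; rewrite fct_sumE.
exact: derive_sum.
Qed.

Lemma derivable_det (m : nat) (B : V -> 'M[R]_m) x v :
  (forall i j, derivable (fun y => B y i j) x v) ->
  derivable (fun y => \det (B y)) x v.
Proof.
elim: m B => [|m IH] B dB.
  have -> : (fun y => \det (B y)) = cst 1.
    by apply: funext => y; rewrite det_mx00.
  exact: derivable_cst.
have -> : (fun y => \det (B y)) = fun y => \sum_j B y ord0 j * cofactor (B y) ord0 j.
  by apply: funext => y; rewrite (expand_det_row _ ord0).
apply: derivable_sumf => j; apply: derivableM; first exact: dB.
rewrite /cofactor; apply: derivableM; first exact: derivable_cst.
apply: IH => i k.
have -> : (fun y => row' ord0 (col' j (B y)) i k)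
    = fun y => B y (lift ord0 i) (lift j k).
  by apply: funext => y; rewrite !mxE.
exact: dB.
Qed.

Lemma derivable_invmx (m : nat) (B : V -> 'M[R]_m) x v i j :
  (\forall y \near x, B y \in unitmx) ->
  (forall i j, derivable (fun y => B y i j) x v) ->
  derivable (fun y => invmx (B y) i j) x v.
Proof.
move=> uB dB.
(* The adjugate formula describes [invmx] only at invertible matrices, hence the passage to a
   neighbourhood of [x]. *)
apply: (@near_eq_derivable _ _ _ (fun y => (\det (B y))^-1 * cofactor (B y) j i)).
  by apply: filterS uB => y uy; rewrite /invmx uy !mxE.
apply: derivableM.
  apply: derivableV; last exact: derivable_det.
  by have := nbhs_singleton uB; rewrite unitmxE unitfE.
rewrite /cofactor; apply: derivableM; first exact: derivable_cst.
apply: derivable_det => k l.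
have -> : (fun y => row' j (col' i (B y)) k l)
    = fun y => B y (lift j k) (lift i l).
  by apply: funext => y; rewrite !mxE.
exact: dB.
Qed.

End PointwiseDerivatives.

Section CoordinateCurvature.
Context {R : realType} {n : nat}.
Local Notation V := 'rV[R]_n.
Variables (U : set V) (A : V -> 'M[R]_n).
Hypotheses (U_open : open U)
  (A_smooth : forall i j, smooth_on U (fun x => A x i j))
  (A_sym : forall x, U x -> (A x)^T = A x)
  (A_unit : forall x, U x -> A x \in unitmx).

Local Notation D i f := ('D_(evec i) f : V -> R).
Local Notation "'A_ i j" := (fun x : V => A x i j)
  (at level 10, i at level 8, j at level 8).

(* Twice the Christoffel symbols of the first kind. *)
Definition chris1 (i j l : 'I_n) (x : V) : R :=
  D i ('A_ j l) x + D j ('A_ i l) x - D l ('A_ i j) x.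

(** [chris2] and [curv] are the Christoffel symbols and curvature components of a matrix field [A]
    on an open set of coordinate space, free of charts. *)
Definition chris2 (i j k : 'I_n) (x : V) : R :=
  2^-1 * \sum_l invmx (A x) k l * chris1 i j l x.

Definition curv (i j k l : 'I_n) (x : V) : R :=
  D i (chris2 j k l) x - D j (chris2 i k l) x
  + \sum_m (chris2 j k m x * chris2 i m l x - chris2 i k m x * chris2 j m l x).

Lemma near_U x : U x -> \forall y \near x, U y.
Proof. by move=> Ux; exact: open_nbhs_nbhs. Qed.

Lemma derivable_A i j k x : U x -> derivable ('A_ i j) x (evec k).
Proof. by move=> Ux; have [_ [h _]] := A_smooth i j 1%N; exact: h. Qed.

Lemma derivable_DA i j k l x : U x -> derivable (D l ('A_ i j)) x (evec k).
Proof.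
by move=> Ux; have [_ [_ h]] := A_smooth i j 2; have [_ [+ _]] := h l; exact.
Qed.

Lemma A_symE i j x : U x -> A x i j = A x j i.
Proof. by move=> Ux; rewrite -[in LHS]A_sym // mxE. Qed.

Lemma DA_sym i j k x : U x -> D k ('A_ i j) x = D k ('A_ j i) x.
Proof.
move=> Ux; apply: near_eq_derive; apply: filterS (near_U x Ux) => y.
exact: A_symE.
Qed.

Lemma DDA_sym i j k l x : U x -> D l (D k ('A_ i j)) x = D l (D k ('A_ j i)) x.
Proof.
move=> Ux; apply: near_eq_derive; apply: filterS (near_U x Ux) => y.
exact: DA_sym.
Qed.

Lemma DDA_swap i j k l x : U x -> D l (D k ('A_ i j)) x = D k (D l ('A_ i j)) x.
Proof.
move=> Ux; have hc k' l' : {for x, continuous (D l' (D k' ('A_ i j)))}.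
  by have [_ [_ h]] := A_smooth i j 2; have [_ [_ h']] := h k'; exact: (h' l').1.
apply: derive_swap; [|exact: hc|exact: hc].
apply: filterS (near_U x Ux) => y Uy.
split; [exact: derivable_A|exact: derivable_A|exact: derivable_DA|].
exact: derivable_DA.
Qed.

Lemma derivable_chris1 i j k l x : U x -> derivable (chris1 i j k) x (evec l).
Proof.
by move=> Ux; apply: derivableB; [apply: derivableD|]; exact: derivable_DA.
Qed.

Lemma derivable_chris2 i j k l x : U x -> derivable (chris2 i j k) x (evec l).
Proof.
move=> Ux; apply: derivableM; first exact: derivable_cst.
apply: derivable_sumf => m; apply: derivableM; last exact: derivable_chris1.
apply: derivable_invmx => [|i' j']; last exact: derivable_A.
by apply: filterS (near_U x Ux) => y; exact: A_unit.
Qed.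

Lemma lower_chris i j l x : U x ->
  \sum_m chris2 i j m x * A x m l = 2^-1 * chris1 i j l x.
Proof.
move=> Ux; pose c := \col_r chris1 i j r x.
transitivity (2^-1 * (A x *m (invmx (A x) *m c)) l 0).
  rewrite mxE mulr_sumr; apply: eq_bigr => m _.
  rewrite /chris2 mxE A_symE // mulrC mulrCA; congr (_ * (_ * _)).
  by apply: eq_bigr => r _; rewrite mxE.
by rewrite mulmxA mulmxV ?A_unit // mul1mx mxE.
Qed.

(** Differentiating [lower_chris] by the product rule lowers the index without ever differentiating
    the inverse metric. *)
Lemma derive_lower_chris i j k l x : U x ->
  \sum_m D i (chris2 j k m) x * A x m l
  = 2^-1 * D i (chris1 j k l) x - \sum_m chris2 j k m x * D i ('A_ m l) x.
Proof.
move=> Ux; apply/eqP; rewrite eq_sym subr_eq -big_split /=; apply/eqP.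
transitivity (D i (fun y => \sum_m chris2 j k m y * A y m l) x).
  transitivity (D i (fun y => 2^-1 *: chris1 j k l y) x).
    by rewrite deriveZ //; exact: derivable_chris1.
  apply: near_eq_derive; apply: filterS (near_U x Ux) => y Uy.
  by rewrite lower_chris.
rewrite derive_sumf => [|m]; last first.
  by apply: derivableM; [exact: derivable_chris2 | exact: derivable_A].
apply: eq_bigr => m _; rewrite deriveM; last 2 first.
- exact: derivable_chris2.
- exact: derivable_A.
by rewrite /GRing.scale /=; ring.
Qed.

(** The metric pairing of nabla_i d_j with nabla_k d_l, hence its symmetries. *)
Definition chris_prod (i j k l : 'I_n) (x : V) : R :=
  \sum_m chris2 i j m x * (2^-1 * chris1 k l m x).

Lemma chris_prodC i j k l x : U x ->
  chris_prod i j k l x = chris_prod k l i j x.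
Proof.
move=> Ux; rewrite /chris_prod.
transitivity (\sum_m \sum_r 2^-1 * 2^-1 * invmx (A x) m r
    * chris1 i j r x * chris1 k l m x).
  apply: eq_bigr => m _; rewrite /chris2 mulr_sumr mulr_suml.
  by apply: eq_bigr => r _; ring.
rewrite exchange_big; apply: eq_bigr => m _; rewrite /chris2 mulr_sumr mulr_suml.
apply: eq_bigr => r _.
have -> : invmx (A x) r m = invmx (A x) m r.
  by rewrite -[in LHS](A_sym _ Ux) -trmx_inv mxE.
ring.
Qed.

Lemma chris_prod_sym i j k l x : U x ->
  chris_prod i j k l x = chris_prod j i k l x.
Proof.
move=> Ux; apply: eq_bigr => m _; congr (_ * _); congr (_ * _).
by apply: eq_bigr => r _; rewrite /chris1 (DA_sym i j) // (addrC (D i _ x)).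
Qed.

Lemma lower_curv i j k l x : U x ->
  \sum_m curv i j k m x * A x m l
  = 2^-1 * (D i (D k ('A_ j l)) x - D i (D l ('A_ j k)) x
            - D j (D k ('A_ i l)) x + D j (D l ('A_ i k)) x)
    - chris_prod j k i l x + chris_prod i k j l x.
Proof.
move=> Ux.
have quad i' j' k' : \sum_m (\sum_r chris2 i' j' r x * chris2 k' r m x) * A x m l
    = \sum_r chris2 i' j' r x * (2^-1 * chris1 k' r l x).
  under eq_bigr do rewrite mulr_suml.
  rewrite exchange_big; apply: eq_bigr => r _; rewrite -lower_chris // mulr_sumr.
  by apply: eq_bigr => m _; rewrite mulrA.
(* Metric compatibility: a first derivative of the metric is the sum of two Christoffel symbols of
   the first kind. One of the resulting sums cancels against [quad]. *)
have low i' j' k' : \sum_m chris2 i' j' m x * D k' ('A_ m l) x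
    = \sum_m chris2 i' j' m x * (2^-1 * chris1 k' m l x) + chris_prod i' j' k' l x.
  rewrite /chris_prod -big_split; apply: eq_bigr => m _ /=; rewrite -mulrDr /chris1.
  congr (_ * _); rewrite (DA_sym l m) //.
  by lra.
have Dchris1 (a b c d : 'I_n) : D a (chris1 b c d) x =
    D a (D b ('A_ c d)) x + D a (D c ('A_ b d)) x - D a (D d ('A_ b c)) x.
  rewrite deriveB; last 2 first.
  - by apply: derivableD; exact: derivable_DA.
  - exact: derivable_DA.
  by rewrite deriveD //; exact: derivable_DA.
transitivity (\sum_m D i (chris2 j k m) x * A x m l
    - \sum_m D j (chris2 i k m) x * A x m l
    + (\sum_m (\sum_r chris2 j k r x * chris2 i r m x) * A x m l
       - \sum_m (\sum_r chris2 i k r x * chris2 j r m x) * A x m l)).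
  rewrite -!sumrB -big_split; apply: eq_bigr => m _.
  by rewrite /curv sumrB mulrDl !mulrBl.
have low_derive a b c := etrans (derive_lower_chris a b c l x Ux)
  (congr2 (fun y z => 2^-1 * y - z) (Dchris1 a b c l) (low b c a)).
rewrite (congr2 +%R (congr2 (fun y z => y - z) (low_derive i j k)
  (low_derive j i k)) (congr2 (fun y z => y - z) (quad j k i) (quad i k j))).
(* [e] is the second derivative of the [k l] entry along [i] and [j], equal in both orders by
   [DDA_swap]; [s] and [t] are the sums from [quad]. *)
have cancel (a b c d e s t y z : R) :
    2^-1 * (e + a - b) - (s + y) - (2^-1 * (e + c - d) - (t + z)) + (s - t)
    = 2^-1 * (a - b - c + d) - y + z by ring.
rewrite (DDA_swap k l j i x Ux); exact: cancel.
Qed.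

Lemma lower_curv_skew i j k l x : U x ->
  \sum_m curv i j k m x * A x m l = - \sum_m curv i j l m x * A x m k.
Proof.
move=> Ux; have skew (a b c d y z : R) :
  2^-1 * (a - b - c + d) - y + z = - (2^-1 * (b - a - d + c) - z + y) by ring.
rewrite (lower_curv i j k l x Ux) (lower_curv i j l k x Ux).
rewrite (chris_prodC j l i k x Ux) (chris_prodC i l j k x Ux).
exact: skew.
Qed.

Lemma lower_curv_pair i j k l x : U x ->
  \sum_m curv i j k m x * A x m l = \sum_m curv k l i m x * A x m j.
Proof.
move=> Ux; have pair (a b c d y z : R) :
  2^-1 * (a - b - c + d) - y + z = 2^-1 * (a - c - b + d) - y + z by ring.
have DD p q r s : D p (D q ('A_ r s)) x = D q (D p ('A_ s r)) x.
  by rewrite (DDA_swap r s q p x Ux) (DDA_sym r s p q x Ux).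
have prod p q r s : chris_prod p q r s x = chris_prod s r q p x.
  rewrite (chris_prod_sym p q r s x Ux) (chris_prodC q p r s x Ux).
  exact: chris_prod_sym.
rewrite (lower_curv i j k l x Ux) (lower_curv k l i j x Ux).
rewrite (prod l i k j) (prod k i l j) (DD k i l j) (DD k j l i).
rewrite (DD l i k j) (DD l j k i) (chris_prodC j l i k x Ux).
exact: pair.
Qed.

End CoordinateCurvature.

(** * The curvature tensor of a metric *)

Section ManifoldCurvature.
Context {R : realType} {n : nat} {M : manifold R n} (g : metric M).
Local Notation V := 'rV[R]_n.
Variables (a : chart M) (p : M).
Hypothesis dom_p : dom a p.

Local Notation U := (coord a @` dom a).
Local Notation A := (fun x : V => g a (param a x)).

Let U_open : open U. Proof. exact: coord_open. Qed.

Lemma dom_param (x : V) : U x -> dom a (param a x).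
Proof. by case=> q hq <-; rewrite coordK. Qed.

Lemma paramK (x : V) : U x -> coord a (param a x) = x.
Proof. by case=> q hq <-; rewrite coordK. Qed.

Lemma christoffelE (i j k : 'I_n) (q : M) : dom a q ->
  christoffel g a i j k q = chris2 A i j k (coord a q).
Proof.
by move=> hq; rewrite /christoffel /chris2 coordK.
Qed.

(** [christoffelE] holds only on the chart domain, but that is open, so the derivatives agree as
    well. *)
Lemma pd_christoffel (i j k l : 'I_n) :
  pd a i (christoffel g a j k l) p
  = 'D_(evec i) (chris2 A j k l) (coord a p).
Proof.
have Up : U (coord a p) by exists p.
apply: near_eq_derive; apply: filterS (near_U U U_open _ Up) => y Uy /=.
by rewrite christoffelE ?paramK //; exact: dom_param.
Qed.

Lemma riem_coefE (i j k l : 'I_n) :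
  riem_coef g a i j k l p = curv A i j k l (coord a p).
Proof.
rewrite /riem_coef /curv !pd_christoffel; congr (_ + _).
by apply: eq_bigr => m _; rewrite !christoffelE.
Qed.

Lemma riem13_linear1 (Y Z : V) : linear (fun X => riem13 g a p X Y Z).
Proof.
move=> t X X'; apply/rowP => l; rewrite !mxE mulr_sumr -big_split.
apply: eq_bigr => i _; rewrite mulr_sumr -big_split.
apply: eq_bigr => j _; rewrite mulr_sumr -big_split.
by apply: eq_bigr => k _; rewrite !mxE /=; ring.
Qed.

Lemma riem13_linear2 (X Z : V) : linear (fun Y => riem13 g a p X Y Z).
Proof.
move=> t Y Y'; apply/rowP => l; rewrite !mxE mulr_sumr -big_split.
apply: eq_bigr => i _; rewrite mulr_sumr -big_split.
apply: eq_bigr => j _; rewrite mulr_sumr -big_split.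
by apply: eq_bigr => k _; rewrite !mxE /=; ring.
Qed.

Lemma riem13_linear3 (X Y : V) : linear (riem13 g a p X Y).
Proof.
move=> t Z Z'; apply/rowP => l; rewrite !mxE mulr_sumr -big_split.
apply: eq_bigr => i _; rewrite mulr_sumr -big_split.
apply: eq_bigr => j _; rewrite mulr_sumr -big_split.
by apply: eq_bigr => k _; rewrite !mxE /=; ring.
Qed.

Lemma sum_evec (i : 'I_n) (c : 'I_n -> R) : \sum_j (evec i : V) 0 j * c j = c i.
Proof.
rewrite (bigD1 i) //= big1 => [|j ji]; first by rewrite mxE !eqxx mul1r addr0.
by rewrite mxE (negPf ji) andbF mul0r.
Qed.

Lemma riem_evec (i j k l : 'I_n) :
  riem g a p (evec i) (evec j) (evec k) (evec l)
  = \sum_m curv A i j k m (coord a p) * A (coord a p) m l.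
Proof.
rewrite /riem /gten /ip coordK //.
have -> : (evec l : V)^T = delta_mx l 0 by rewrite trmx_delta.
rewrite -colE !mxE; apply: eq_bigr => m _; congr (_ * _).
rewrite mxE -riem_coefE.
transitivity (\sum_i' (evec i : V) 0 i' * \sum_j' (evec j : V) 0 j' *
    \sum_k' (evec k : V) 0 k' * riem_coef g a i' j' k' m p).
  apply: eq_bigr => i' _; rewrite mulr_sumr; apply: eq_bigr => j' _.
  rewrite mulrA mulr_sumr; apply: eq_bigr => k' _.
  by rewrite !mulrA.
by rewrite (sum_evec i) (sum_evec j) (sum_evec k).
Qed.

Lemma riem_scalar1 Y Z W : scalar (fun X => riem g a p X Y Z W).
Proof. by move=> t X X'; rewrite /riem /gten riem13_linear1 ipDl ipZl. Qed.

Lemma riem_scalar2 X Z W : scalar (fun Y => riem g a p X Y Z W).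
Proof. by move=> t Y Y'; rewrite /riem /gten riem13_linear2 ipDl ipZl. Qed.

Lemma riem_scalar3 X Y W : scalar (fun Z => riem g a p X Y Z W).
Proof. by move=> t Z Z'; rewrite /riem /gten riem13_linear3 ipDl ipZl. Qed.

Lemma riem_scalar4 X Y Z : scalar (riem g a p X Y Z).
Proof. by move=> t W W'; apply: ipPr; exact: gmx_sym. Qed.

Let A_smooth i j : smooth_on U (fun x => A x i j).
Proof. exact: (gmx_smooth g a i j). Qed.

Let A_sym x : U x -> (A x)^T = A x.
Proof. by move=> Ux; apply: gmx_sym; exact: dom_param. Qed.

Let A_unit x : U x -> A x \in unitmx.
Proof. by move=> Ux; apply: gmx_unit; exact: dom_param. Qed.

(** Multilinearity reduces the claim, one slot at a time, to basis vectors, where it is the symmetry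
    of the lowered components. *)
Lemma riem_skew (X Y Z W : V) : riem g a p X Y Z W = - riem g a p X Y W Z.
Proof.
apply: (scalar_ext (fun X => riem g a p X Y Z W) (fun X => - riem g a p X Y W Z));
  [exact: riem_scalar1 | apply: scalarN; exact: riem_scalar1 | move=> i].
apply: (scalar_ext (fun Y => riem g a p _ Y Z W) (fun Y => - riem g a p _ Y W Z));
  [exact: riem_scalar2 | apply: scalarN; exact: riem_scalar2 | move=> j].
apply: (scalar_ext (fun Z => riem g a p _ _ Z W) (fun Z => - riem g a p _ _ W Z));
  [exact: riem_scalar3 | apply: scalarN; exact: riem_scalar4 | move=> k].
apply: (scalar_ext (fun W => riem g a p _ _ _ W) (fun W => - riem g a p _ _ W _));
  [exact: riem_scalar4 | apply: scalarN; exact: riem_scalar3 | move=> l].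
rewrite !riem_evec; apply: (lower_curv_skew U A U_open) => //.
Qed.

Lemma riem_pair (X Y Z W : V) : riem g a p X Y Z W = riem g a p Z W X Y.
Proof.
apply: (scalar_ext (fun X => riem g a p X Y Z W) (fun X => riem g a p Z W X Y));
  [exact: riem_scalar1 | exact: riem_scalar3 | move=> i].
apply: (scalar_ext (fun Y => riem g a p _ Y Z W) (fun Y => riem g a p Z W _ Y));
  [exact: riem_scalar2 | exact: riem_scalar4 | move=> j].
apply: (scalar_ext (fun Z => riem g a p _ _ Z W) (fun Z => riem g a p Z W _ _));
  [exact: riem_scalar3 | exact: riem_scalar1 | move=> k].
apply: (scalar_ext (fun W => riem g a p _ _ _ W) (fun W => riem g a p _ W _ _));
  [exact: riem_scalar4 | exact: riem_scalar2 | move=> l].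
rewrite !riem_evec; apply: (lower_curv_pair U A U_open) => //.
Qed.

End ManifoldCurvature.

(** * Assembly of the pointwise identities over the manifold *)

Theorem theorem4p13 (R : realType) (n : nat) (hn : (3 <= n)%N)
  (M : manifold R n) (hM : connected [set: M]) (g : metric M)
  (L : M -> R) (hL : smooth_fun L)
  (hP : forall (a : chart M) (p : M), dom a p ->
    forall X1 X2 X3 X Y : 'rV[R]_n,
      dot13 (g a p) (projective g a p) (riem13 g a p) X1 X2 X3 X Y
      = L p *: Q13 (gten g a p) (riem13 g a p) X1 X2 X3 X Y) :
  (* (i) *)
  ((forall (a : chart M) (p : M), dom a p -> forall X1 X2 X Y : 'rV[R]_n,
      dot02 (g a p) (projective g a p) (ric g a p) X1 X2 X Y
      = dot02 (g a p) (riem g a p) (ric g a p) X1 X2 X Y /\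
      dot02 (g a p) (riem g a p) (ric g a p) X1 X2 X Y
      = L p * Q02 (gten g a p) (ric g a p) X1 X2 X Y) /\
   (forall (a : chart M) (p : M), dom a p -> forall X Y : 'rV[R]_n,
      Etensor g a p X Y
      = L p * scal g a p * gten g a p X Y - L p * n%:R * ric g a p X Y
        + ric2 g a p X Y))
  /\
  (* (ii) *)
  ((forall (a : chart M) (p : M), dom a p -> forall X Y : 'rV[R]_n,
      n%:R ^+ 2 * ric2 g a p X Y - 2 * n%:R * scal g a p * ric g a p X Y
      + scal g a p ^+ 2 * gten g a p X Y = 0) /\
   (forall (a : chart M) (p : M), dom a p ->
      scal2 g a p = scal g a p ^+ 2 / n%:R) /\
   (riemannian g -> einstein g))
  /\
  (* (iii) *)
  (forall (a : chart M) (p : M), dom a p -> forall X1 X2 X3 X4 : 'rV[R]_n,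
     kulkarni_nomizu (ric g a p) (ric g a p) X1 X2 X3 X4
     = kulkarni_nomizu (gten g a p) (ric2 g a p) X1 X2 X3 X4)
  /\
  (* (iv) *)
  (((forall (a : chart M) (p : M), dom a p -> forall X1 X Y : 'rV[R]_n,
       dot11 (g a p) (projective g a p) (ric_op g a p) X1 X Y
       = L p *: Q11 (gten g a p) (ric_op g a p) X1 X Y)
    <->
    (forall X1 X2 X Y : vector_field M,
       (forall (a : chart M) (p : M), dom a p ->
          riem g a p (Y a p) (X1 a p) (X2 a p) (ric_op g a p (X a p))
          + riem g a p (Y a p) (X2 a p) (X1 a p) (ric_op g a p (X a p))
          - riem g a p (X a p) (X1 a p) (X2 a p) (ric_op g a p (Y a p))
          - riem g a p (X a p) (X2 a p) (X1 a p) (ric_op g a p (Y a p)) = 0)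
       \/
       (forall (a : chart M) (p : M), dom a p ->
          ric g a p (X a p) (X2 a p) * ric g a p (X1 a p) (Y a p)
          - ric g a p (X a p) (X1 a p) * ric g a p (X2 a p) (Y a p)
          + gten g a p (X2 a p) (Y a p) * ric2 g a p (X a p) (X1 a p)
          - gten g a p (X a p) (X2 a p) * ric2 g a p (X1 a p) (Y a p) = 0)))
   /\
   ((forall (a : chart M) (p : M), dom a p ->
       forall X1 X2 X3 X4 X Y : 'rV[R]_n,
       Q04 (ric g a p) (riem g a p) X1 X2 X3 X4 X Y = 0) ->
    (forall (a : chart M) (p : M), dom a p ->
       forall X1 X2 X3 X Y : 'rV[R]_n,
       dot13 (g a p) (projective g a p) (riem13 g a p) X1 X2 X3 X Y = 0) ->
    (forall (a : chart M) (p : M), dom a p -> forall X1 X Y : 'rV[R]_n,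
       dot11 (g a p) (projective g a p) (ric_op g a p) X1 X Y = 0))).
Proof.
have G_sym := @gmx_sym _ _ _ g; have G_unit := @gmx_unit _ _ _ g.
have l1 a p := riem13_linear1 g a p; have l2 a p := riem13_linear2 g a p.
have l3 a p := riem13_linear3 g a p.
have sk a p hp := riem_skew g a p hp; have pr a p hp := riem_pair g a p hp.
have PS a p (hp : dom a p) := dot02_proj_ric (g a p) (riem13 g a p)
  (G_sym a p hp) (G_unit a p hp) (l1 a p) (l3 a p) (L p) (hP a p hp).
have RS a p (hp : dom a p) := dot02_rm_ric (g a p) (riem13 g a p)
  (G_sym a p hp) (G_unit a p hp) (l3 a p) (sk a p hp) (pr a p hp).
have SC a p (hp : dom a p) X Y : ric g a p X Y = ric g a p Y X.
  exact: (ricC (g a p) (riem13 g a p)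
    (G_sym a p hp) (G_unit a p hp) (sk a p hp) (pr a p hp)).
have SQ a p (hp : dom a p) X Y :
    ric g a p (ric_op g a p X) Y = ric g a p X (ric_op g a p Y).
  exact: (ric_ricopC (g a p) (riem13 g a p) (G_sym a p hp) (G_unit a p hp)
    (l3 a p) (sk a p hp) (pr a p hp)).
have ric2E a p (hp : dom a p) X Y :
    ric2 g a p X Y = ric g a p X (ric_op g a p Y).
  rewrite -SQ //.
  exact: (ip_ricop (g a p) (riem13 g a p) (G_unit a p hp) (l3 a p)).
have wedge a p (hp : dom a p) X1 X Y W :
    ric g a p X1 (ric_op g a p Y) * gten g a p X W
    - ric g a p X1 (ric_op g a p X) * gten g a p Y W
    + ric g a p Y W * ric g a p X1 X - ric g a p X W * ric g a p X1 Y = 0.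
  exact: (ric_wedge_ric (g a p) (riem13 g a p)
    (G_sym a p hp) (G_unit a p hp) hn (l2 a p) (l3 a p)
    (sk a p hp) (pr a p hp) (L p) (hP a p hp)).
have PQ a p (hp : dom a p) := dot11_proj_ricop (g a p) (riem13 g a p)
  (G_sym a p hp) (G_unit a p hp) hn (l2 a p) (l3 a p)
  (sk a p hp) (pr a p hp) (L p) (hP a p hp).
have gC a p (hp : dom a p) X Y : gten g a p X Y = gten g a p Y X.
  exact: (ipC (g a p) (G_sym a p hp)).
split; [split|split; [split; [|split]|split; [|split; [split|]]]].
- move=> a p hp X1 X2 X Y; split; first exact: (esym (RS a p hp _ _ _ _)).
  exact: (etrans (RS a p hp _ _ _ _) (PS a p hp _ _ _ _)).
- move=> a p hp X Y; rewrite ric2E //.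
  exact: (contract_rm_ricop (g a p) (riem13 g a p)
    (G_sym a p hp) (G_unit a p hp) hn (l1 a p) (l3 a p)
    (sk a p hp) (pr a p hp) (L p) (hP a p hp)).
- move=> a p hp X Y; rewrite ric2E //.
  exact: (ric_quadratic (g a p) (riem13 g a p)
    (G_sym a p hp) (G_unit a p hp) hn (l2 a p) (l3 a p)
    (sk a p hp) (pr a p hp) (L p) (hP a p hp)).
- move=> a p hp.
  exact: (tr_ricop_sq (g a p) (riem13 g a p)
    (G_sym a p hp) (G_unit a p hp) hn (l3 a p)
    (sk a p hp) (pr a p hp) (L p) (hP a p hp)).
- move=> pos a p hp X Y.
  exact: (ric_proportional (g a p) (riem13 g a p)
    (G_sym a p hp) (G_unit a p hp) hn (l2 a p) (l3 a p)
    (sk a p hp) (pr a p hp) (L p) (hP a p hp) X Y (pos a p hp)).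
- move=> a p hp X1 X2 X3 X4.
  rewrite /kulkarni_nomizu !ric2E //.
  (* Each instance contains two of the four terms of g /\ S^2 and half of S /\ S; the claim is their
     sum. *)
  have := wedge a p hp X2 X4 X3 X1; have := wedge a p hp X1 X3 X4 X2.
  rewrite !(gC a p hp _ X1) !(gC a p hp _ X2) !(SC a p hp _ X1).
  rewrite (SC a p hp X4 X2) (SC a p hp X3 X2); lra.
- move=> _ X1 X2 X Y; right=> a p hp; rewrite !ric2E //.
  (* Up to sign, the second alternative is [wedge] at the values of the fields. *)
  have := wedge a p hp (X1 a p) (X a p) (Y a p) (X2 a p).
  rewrite -(SQ a p hp (X a p)) (SC a p hp (ric_op _ _ _ _)).
  rewrite (gC a p hp (Y a p)) (SC a p hp (Y a p)) (SC a p hp (X1 a p) (X a p)).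
  move=> h; rewrite -[RHS]oppr0 -h; ring.
- move=> _ a p hp X1 X Y; rewrite PQ //.
  exact: esym (L_Q11_ricop (g a p) (riem13 g a p)
    (G_sym a p hp) (G_unit a p hp) hn (l1 a p) (l3 a p)
    (sk a p hp) (pr a p hp) (L p) (hP a p hp) X1 X Y).
- by move=> _ _ a p hp X1 X Y; exact: PQ.
Qed.
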